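(* There are no implicit relations in critical graphs: if $G$ is a $k$-critical graph, then $G$ has no implicit-edge (drawn or not) and no implicit-identity.
   Context: All graphs are simple (undirected, no loops, no multiple edges). A $k$-coloring is a proper vertex coloring using a set of $k$ colors; $\chi(G)$ is the chromatic number and $G$ is $k$-chromatic if $\chi(G)=k$. An element $x$ (vertex or edge) of $G$ is critical if $\chi(G-x)<\chi(G)$; $G$ is $k$-critical if $\chi(G)=k$ and every vertex and every edge of $G$ is critical. For distinct vertices $i,j$ of $G$, $G-ij$ denotes $G$ with the edge $\{i,j\}$ deleted if it is present (and $G-ij=G$ if $\{i,j\}\notin E(G)$). For a $k$-chromatic graph $G$: a 2-subset $\{i,j\}$ of $V(G)$ is an implicit-edge of $G$ if there is no $k$-coloring of $G-ij$ in which $i$ and $j$ receive the same color; it is called drawn if $\{i,j\}\in E(G)$ and non-drawn otherwise. A 2-subset $\{i,j\}$ of $V(G)$ with $\{i,j\}\notin E(G)$ is an implicit-identity of $G$ if $i$ and $j$ receive the same color in every $k$-coloring of $G$. An implicit relation is an implicit-edge or an implicit-identity. *)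

(* Defs.v *)
From mathcomp Require Import all_boot.

Set Implicit Arguments.
Unset Strict Implicit.
Unset Printing Implicit Defensive.

Record sgraph := SGraph {
  vertex :> finType;
  adj : rel vertex;
  adj_sym : symmetric adj;
  adj_irr : irreflexive adj
}.

(* A k-coloring takes its colors in a set of size k; not all of them have to be
   used. *)
Definition coloring (G : sgraph) (k : nat) (c : {ffun G -> 'I_k}) : bool :=
  [forall x : G, forall y : G, adj x y ==> (c x != c y)].
Arguments coloring G {k} c.

Definition colorable (G : sgraph) (k : nat) : bool :=
  [exists c : {ffun G -> 'I_k}, coloring G c].

Lemma colorable_card (G : sgraph) : colorable G #|G|.
Proof.
apply/existsP; exists [ffun x => enum_rank x].
apply/forallP=> x; apply/forallP=> y; apply/implyP=> xy.
rewrite !ffunE (inj_eq enum_rank_inj).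
by apply: contraTneq xy => ->; rewrite adj_irr.
Qed.

Lemma ex_colorable (G : sgraph) : exists k, colorable G k.
Proof. by exists #|G|; apply: colorable_card. Qed.

Definition chi (G : sgraph) : nat := ex_minn (ex_colorable G).

Definition del_vertex_adj (G : sgraph) (v : G) : rel {x : G | x != v} :=
  fun x y => adj (val x) (val y).

Lemma del_vertex_sym (G : sgraph) (v : G) : symmetric (@del_vertex_adj G v).
Proof. by move=> x y; apply: adj_sym. Qed.

Lemma del_vertex_irr (G : sgraph) (v : G) : irreflexive (@del_vertex_adj G v).
Proof. by move=> x; apply: adj_irr. Qed.

Definition del_vertex (G : sgraph) (v : G) : sgraph :=
  SGraph (@del_vertex_sym G v) (@del_vertex_irr G v).

Definition del_edge_adj (G : sgraph) (i j : G) : rel G :=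
  fun x y => adj x y && ([set x; y] != [set i; j]).

Lemma del_edge_sym (G : sgraph) (i j : G) : symmetric (del_edge_adj i j).
Proof. by move=> x y; rewrite /del_edge_adj adj_sym setUC. Qed.

Lemma del_edge_irr (G : sgraph) (i j : G) : irreflexive (del_edge_adj i j).
Proof. by move=> x; rewrite /del_edge_adj adj_irr. Qed.

Definition del_edge (G : sgraph) (i j : G) : sgraph :=
  SGraph (@del_edge_sym G i j) (@del_edge_irr G i j).

Definition critical_vertex (G : sgraph) (v : G) : Prop :=
  chi (del_vertex v) < chi G.

Definition critical_edge (G : sgraph) (i j : G) : Prop :=
  chi (del_edge i j) < chi G.

Definition critical (k : nat) (G : sgraph) : Prop :=
  [/\ chi G = k,
      forall v : G, critical_vertex v
    & forall i j : G, adj i j -> critical_edge i j].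

(* Every graph G is k-chromatic for exactly one k, namely chi G, so this is the
   number of colors used below. The 2-subset {i, j} is given by two distinct
   vertices i and j. The pair may be an edge of G (a drawn implicit-edge) or not (a
   non-drawn one). *)
Definition implicit_edge (G : sgraph) (i j : G) : Prop :=
  i != j /\
  ~ exists c : {ffun del_edge i j -> 'I_(chi G)},
      coloring (del_edge i j) c /\ c i = c j.

Definition implicit_identity (G : sgraph) (i j : G) : Prop :=
  [/\ i != j, ~~ adj i j
    & forall c : {ffun G -> 'I_(chi G)}, coloring G c -> c i = c j].

(* Main.v *)
Require Import Defs.
From mathcomp Require Import all_boot.

(* Since v is critical, G - v has a coloring with fewer than chi G colors; hence a
   color is left over, and it can be given to v and to any other vertices. If i is v,
   giving it to i and j alone refutes an implicit-edge {i, j} (also a drawn one, as G - ij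
   lacks the edge), and giving it to i alone refutes an implicit-identity. *)

Lemma colorable_chi (G : sgraph) : colorable G (chi G).
Proof. by rewrite /chi; case: ex_minnP. Qed.

(** A coloring of G - v gives [v] no color, so [v] must lie in [S]; edges inside [S] are exempt, as
    both ends receive [a]. *)
Lemma critical_vertex_recolor (G : sgraph) (v : G) (S : {set G}) :
  critical_vertex v -> v \in S ->
  exists (c : {ffun G -> 'I_(chi G)}) (a : 'I_(chi G)),
    (forall x, (c x == a) = (x \in S)) /\
    (forall x y, adj x y -> ~~ ((x \in S) && (y \in S)) -> c x != c y).
Proof.
move=> ltk vS; have /existsP[c /forallP cP] := colorable_chi (del_vertex v).
(* The colors of [c] are the numbers below [chi (del_vertex v)]; that number itself is the spare
   color. *)
pose a := Ordinal ltk.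
(* The default of [oapp] is never reached: [insub x] fails only at [v], which is in [S]. *)
pose f x : 'I_(chi G) := if x \in S then a else
  oapp (fun u : del_vertex v => widen_ord (ltnW ltk) (c u)) a (insub x).
have fP x : x \notin S ->
    exists2 u : del_vertex v, val u = x & f x = widen_ord (ltnW ltk) (c u).
  move=> xS; have xv : x != v by apply: contraNneq xS => ->.
  by exists (Sub x xv) => //; rewrite /f (negPf xS) insubT.
have faE x : (f x == a) = (x \in S).
  have [xS|/fP[u _ ->]] := boolP (x \in S); first by rewrite /f xS eqxx.
  by apply/negbTE; rewrite -val_eqE /= ltn_eqF.
exists [ffun x => f x], a; split=> [x|x y xy xyS]; rewrite !ffunE //.
have [xS|xS] := boolP (x \in S).
  have /eqP-> : f x == a by rewrite faE.
  by rewrite eq_sym faE; rewrite xS in xyS.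
have [yS|yS] := boolP (y \in S).
  by have /eqP-> : f y == a; rewrite faE.
have [[u ux ->] [w wy ->]] := (fP x xS, fP y yS).
have /forallP/(_ w)/implyP := cP u; rewrite -val_eqE; apply.
by rewrite /= /del_vertex_adj ux wy.
Qed.

Theorem theorem3p17 (k : nat) (G : sgraph) (hG : critical k G) :
  ~ (exists i j : G, implicit_edge i j) /\
  ~ (exists i j : G, implicit_identity i j).
Proof.
case: hG => _ critV _; split=> -[i [j []]].
- move=> _; apply.
  have [c [a [ca cP]]] := @critical_vertex_recolor G i [set i; j] (critV i) (set21 i j).
  exists c; split; last first.
    have caS x : x \in [set i; j] -> c x = a by rewrite -ca => /eqP.
    by rewrite !caS ?set21 ?set22.
  apply/forallP=> x; apply/forallP=> y; apply/implyP=> /andP[xy ne_xy].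
  apply: cP => //; apply: contra ne_xy => xyS.
  have ne : x != y by apply: contraTneq xy => ->; rewrite adj_irr.
  (* An edge inside [[set i; j]] fills it, by cardinality, so it is the deleted pair. *)
  by rewrite eqEcard subUset !sub1set xyS !cards2 ne; case: (i != j).
- move=> ne_ij _ cij.
  have [c [a [ca cP]]] := @critical_vertex_recolor G i [set i] (critV i) (set11 i).
  have col : coloring G c.
    apply/forallP=> x; apply/forallP=> y; apply/implyP=> xy; apply: cP => //.
    by rewrite !inE; apply: contraTN xy => /andP[/eqP-> /eqP->]; rewrite adj_irr.
  (* [j] shares the color [a] of [i], which no vertex outside [[set i]] has. *)
  have := ca j; rewrite -(cij c col) ca !inE eqxx eq_sym.
  by rewrite (negPf ne_ij).
Qed.
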